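(* Let $H$ be a simple hypergraph with $e$-index $k$. Let $\ell^+$ and $\ell^-$ denote the number of positive and negative eigenvalues (counted with multiplicity) of the unified matrix $\mathbf{U}(H)$, respectively. Then the independence number of $H$ satisfies $\alpha(H)\leq\min\{k-\ell^+,\,k-\ell^-\}$.
   Context: A hypergraph $H$ consists of a finite non-empty vertex set $V(H)$ and a multiset $E(H)$ of non-empty subsets of $V(H)$, called edges. It is simple if it has no loops (edges of cardinality one) and no multiple edges. A 2-partition of a set $e$ is an unordered pair $\{S,S'\}$ of non-empty disjoint sets with $S\cup S'=e$; $S$ and $S'$ are called parts of $e$. $I(H)$ is the set of all parts of all edges of $H$ together with all singleton subsets of $V(H)$, and $k=|I(H)|$ is the $e$-index of $H$. For simple $H$, the unified matrix $\mathbf{U}(H)$ is the $k\times k$ matrix indexed by $I(H)$ whose $(S,S')$ entry is $1$ if $\{S,S'\}$ is a 2-partition of an edge of $H$, and $0$ otherwise. A set of vertices of $H$ which contains no edge of $H$ (as a subset) is an independent set; $\alpha(H)$ is the cardinality of a largest independent set in $H$. *)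

(* Defs.v *)
From HB Require Import structures.
From mathcomp Require Import all_boot all_order all_algebra.
From mathcomp Require Import finmap multiset.

Set Implicit Arguments.
Unset Strict Implicit.
Unset Printing Implicit Defensive.

Import Order.TTheory GRing.Theory Num.Theory.
Local Open Scope ring_scope.

Record hypergraph := Hypergraph {
  vertex : finType;
  edges : {mset {set vertex}}%mset;
  vertex_nonempty : (0 < #|vertex|)%N;
  edges_nonempty : set0 \notin edges
}.

(* [edges H e] is the multiplicity of [e] in the multiset [edges H]. *)
Definition simple (H : hypergraph) : Prop :=
  (forall e : {set vertex H}, e \in edges H -> #|e| != 1%N) /\
  (forall e : {set vertex H}, (edges H e <= 1)%N).

(* The unordered pair {S, S'} is a set of blocks, so S = S' is excluded by the
   cardinality condition; [partition] requires non-empty disjoint blocks. *)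
Definition two_partition (T : finType) (P : {set {set T}}) (e : {set T}) :=
  partition P e && (#|P| == 2%N).

Definition is_part (T : finType) (S e : {set T}) : bool :=
  [exists P : {set {set T}}, two_partition P e && (S \in P)].

Definition index_set (H : hypergraph) : {set {set vertex H}} :=
  [set S | [exists e : {set vertex H}, (e \in edges H) && is_part S e]]
  :|: [set [set v] | v : vertex H].

Definition e_index (H : hypergraph) : nat := #|index_set H|.

(* Rows and columns are numbered by the enumeration of [index_set H]. *)
Definition unified_matrix (R : nzRingType) (H : hypergraph) :
    'M[R]_(e_index H) :=
  \matrix_(i, j)
    [exists e : {set vertex H}, (e \in edges H) &&
       two_partition [set enum_val i; enum_val j] e]%:R.

(* The roots of the characteristic polynomial, repeated according to their
   multiplicity. *)
Definition eigenvalues (C : closedFieldType) (n : nat) (A : 'M[C]_n) : seq C :=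
  sval (closed_field_poly_normal (char_poly A)).

(* In a [numClosedFieldType], [0 < x] and [x < 0] both entail that x is real. *)
Definition num_pos_eigenvalues (C : numClosedFieldType) (n : nat)
    (A : 'M[C]_n) : nat :=
  count (fun x => 0 < x) (eigenvalues A).

Definition num_neg_eigenvalues (C : numClosedFieldType) (n : nat)
    (A : 'M[C]_n) : nat :=
  count (fun x => x < 0) (eigenvalues A).

Definition independent (H : hypergraph) (A : {set vertex H}) : bool :=
  [forall e : {set vertex H}, (e \in edges H) ==> ~~ (e \subset A)].

Definition independence_number (H : hypergraph) : nat :=
  \max_(A : {set vertex H} | independent A) #|A|.

(* Main.v *)
Require Import Defs.
From HB Require Import structures.
From mathcomp Require Import all_boot all_order all_algebra.
From mathcomp Require Import finmap multiset.

(** Why the theorem is true: let A be an independent set.  The principal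
    submatrix of the unified matrix U indexed by the singletons {v}, v in A,
    is zero, since a nonzero entry at ({v}, {w}) would make {v, w} an edge
    inside A ([unified_matrix_singletons]).  Hence the |A|-dimensional space
    spanned by the corresponding unit vectors is totally isotropic for the
    quadratic form x |-> x U x^*.  By the inertia bound
    ([isotropic_pos_eigenvalues], [isotropic_neg_eigenvalues]), a Hermitian
    form in k variables which vanishes on an m-dimensional space has at most
    k - m positive and at most k - m negative eigenvalues, because it is definite on the span
    of the eigenvectors of either sign, which therefore meets the isotropic
    space trivially.  The spectral theorem reduces that bound to diagonal forms
    ([isotropic_diag]). *)

Set Implicit Arguments.
Unset Strict Implicit.
Unset Printing Implicit Defensive.

Import Order.TTheory GRing.Theory Num.Theory.
Local Open Scope ring_scope.
Local Open Scope sesquilinear_scope.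

(** * Inertia bound for Hermitian forms *)

Lemma diag_formE (C : numClosedFieldType) (n : nat) (d u : 'rV[C]_n) :
  (u *m diag_mx d *m u ^t*) 0 0 = \sum_j d 0 j * `|u 0 j| ^+ 2.
Proof.
rewrite mul_mx_diag mxE.
by apply: eq_bigr => j _; rewrite !mxE normCK mulrCA mulrA.
Qed.

(** Isotropy makes the projection of the row space of [B] to the coordinates
    [j] with [~~ (0 < d 0 j)] injective: at a vector [u] of its kernel the
    form is the sum of the nonnegative terms [d 0 j * `|u 0 j| ^+ 2] over the
    remaining coordinates, and a vanishing sum forces [u = 0]. *)
Lemma isotropic_diag (C : numClosedFieldType) (m n : nat)
    (d : 'rV[C]_n) (B : 'M[C]_(m, n)) :
  row_free B -> B *m diag_mx d *m B ^t* = 0 ->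
  (m + #|[pred j | (0 < d 0 j)%R]| <= n)%N.
Proof.
move=> freeB isoB; set pos := [pred j | _].
have freeN : row_free (colsub (enum_val : 'I_#|predC pos| -> 'I_n) B).
  apply: inj_row_free => v; rewrite mulmx_colsub => vB0.
  pose u := v *m B.
  have uN0 j : ~~ (0 < d 0 j) -> u 0 j = 0.
    move=> jN; have jP : j \in predC pos by rewrite !inE.
    have /rowP/(_ (enum_rank_in jP j)) := vB0.
    by rewrite !mxE enum_rankK_in.
  have sum0 : \sum_j d 0 j * `|u 0 j| ^+ 2 = 0.
    have : u *m diag_mx d *m u ^t* = 0.
      by rewrite trmx_mul map_mxM /= !mulmxA -(mulmxA v) -(mulmxA v) isoB
                 mulmx0 mul0mx.
    by move=> /matrixP/(_ 0 0); rewrite diag_formE [in RHS]mxE.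
  have term_ge0 j : 0 <= d 0 j * `|u 0 j| ^+ 2.
    have [dj|/uN0->] := boolP (0 < d 0 j).
      by rewrite mulr_ge0 ?exprn_ge0 // ltW.
    by rewrite normr0 expr0n mulr0.
  have u0 : u = 0.
    apply/rowP => j; rewrite [RHS]mxE.
    have [dj|/uN0//] := boolP (0 < d 0 j).
    have /psumr_eq0P := sum0 => /(_ (fun j _ => term_ge0 j)) /(_ j isT) /eqP.
    by rewrite mulf_eq0 gt_eqF //= sqrf_eq0 normr_eq0 => /eqP.
  by apply: (row_free_inj freeB); rewrite mul0mx.
have: (m <= #|predC pos|)%N by rewrite -(eqP freeN) rank_leq_col.
rewrite -(leq_add2r #|pos|) => /leq_trans; apply.
by rewrite [leqLHS]addnC cardC card_ord.
Qed.

Lemma char_poly_conj (F : fieldType) (n : nat) (P A : 'M[F]_n) :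
  P \in unitmx -> char_poly (invmx P *m A *m P) = char_poly A.
Proof.
move=> Pu.
have PKpoly : map_mx polyC (invmx P) *m map_mx polyC P = 1%:M.
  by rewrite -map_mxM mulVmx // map_mx1.
rewrite /char_poly.
have -> : char_poly_mx (invmx P *m A *m P) =
    map_mx polyC (invmx P) *m char_poly_mx A *m map_mx polyC P.
  rewrite /char_poly_mx !map_mxM mulmxBr mulmxBl; congr (_ - _).
  by rewrite scalar_mxC -mulmxA PKpoly mulmx1.
by rewrite !det_mulmx mulrC mulrA -det_mulmx (mulmx1C PKpoly) det1 mul1r.
Qed.

(** Similar matrices have the same characteristic polynomial, so unitary
    diagonalization lists the eigenvalues with their algebraic
    multiplicities. *)
Lemma count_eigenvalues_hermitian (C : numClosedFieldType) (n : nat)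
    (A : 'M[C]_n) (p : pred C) :
  A \is hermsymmx ->
  count p (eigenvalues A) = #|[pred j | p (spectral_diag A 0 j)]|.
Proof.
move=> /hermitian_normalmx/orthomx_spectralP defA.
have : perm_eq (eigenvalues A) [seq spectral_diag A 0 j | j : 'I_n].
  apply: prod_XsubC_eq; rewrite /eigenvalues.
  case: closed_field_poly_normal => r /=.
  rewrite (monicP (char_poly_monic A)) scale1r => <-.
  rewrite [in LHS]defA char_poly_conj ?spectral_unit //.
  rewrite char_poly_trig ?diag_mx_is_trig // big_image /=.
  by apply: eq_bigr => j _; rewrite mxE eqxx mulr1n.
move=> /permP->; rewrite count_map -size_filter cardE.
by rewrite enumT [in RHS]/enum_mem; congr size; apply: eq_filter.
Qed.

(** In an orthonormal eigenbasis the form is diagonal, and a matrix with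
    independent rows still has independent rows in the new coordinates. *)
Lemma isotropic_spectral (C : numClosedFieldType) (m n : nat)
    (A : 'M[C]_n) (B : 'M[C]_(m, n)) :
  A \is hermsymmx -> row_free B -> B *m A *m B ^t* = 0 ->
  exists2 B' : 'M[C]_(m, n), row_free B' &
    B' *m diag_mx (spectral_diag A) *m B' ^t* = 0.
Proof.
move=> /hermitian_normalmx/orthomx_spectralP defA freeB isoB.
have Pu := spectral_unitarymx A.
exists (B *m (spectralmx A) ^t*).
  rewrite /row_free mxrankMfree // -invmx_unitary //.
  by rewrite row_free_unit unitmx_inv spectral_unit.
move: isoB; rewrite {1}defA invmx_unitary // => <-.
by rewrite trmx_mul map_mxM /= trmxCK !mulmxA.
Qed.

Lemma isotropic_pos_eigenvalues (C : numClosedFieldType) (m n : nat)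
    (A : 'M[C]_n) (B : 'M[C]_(m, n)) :
  A \is hermsymmx -> row_free B -> B *m A *m B ^t* = 0 ->
  (m + num_pos_eigenvalues A <= n)%N.
Proof.
move=> hA freeB /(isotropic_spectral hA freeB)[B' freeB' isoB'].
rewrite /num_pos_eigenvalues count_eigenvalues_hermitian //.
exact: isotropic_diag isoB'.
Qed.

Lemma isotropic_neg_eigenvalues (C : numClosedFieldType) (m n : nat)
    (A : 'M[C]_n) (B : 'M[C]_(m, n)) :
  A \is hermsymmx -> row_free B -> B *m A *m B ^t* = 0 ->
  (m + num_neg_eigenvalues A <= n)%N.
Proof.
move=> hA freeB /(isotropic_spectral hA freeB)[B' freeB' isoB'].
rewrite /num_neg_eigenvalues count_eigenvalues_hermitian //.
(* An isotropic space of the form is isotropic for its opposite. *)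
have isoN : B' *m diag_mx (- spectral_diag A) *m B' ^t* = 0.
  by rewrite raddfN /= mulmxN mulNmx isoB' oppr0.
apply: leq_trans (isotropic_diag freeB' isoN); rewrite leq_add2l.
by apply/subset_leq_card/subsetP => j; rewrite !inE mxE oppr_gt0.
Qed.

(** * The unified matrix and independent sets *)

Lemma unified_matrix_hermitian (C : numClosedFieldType) (H : hypergraph) :
  unified_matrix C H \is hermsymmx.
Proof.
apply/is_hermitianmxP; rewrite expr0 scale1r; apply/matrixP => i j.
by rewrite !mxE conjC_nat; under eq_existsb do rewrite setUC.
Qed.

Lemma singleton_in_index_set (H : hypergraph) (v : vertex H) :
  [set v] \in index_set H.
Proof. by rewrite inE imset_f ?orbT. Qed.

Definition singleton_index (H : hypergraph) (v : vertex H) : 'I_(e_index H) :=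
  enum_rank_in (singleton_in_index_set v) [set v].

Lemma enum_val_singleton_index (H : hypergraph) (v : vertex H) :
  enum_val (singleton_index v) = [set v].
Proof. by rewrite enum_rankK_in ?singleton_in_index_set. Qed.

Lemma singleton_index_inj (H : hypergraph) : injective (@singleton_index H).
Proof.
move=> v w /(congr1 enum_val); rewrite !enum_val_singleton_index.
exact: set1_inj.
Qed.

(** An edge with 2-partition [{{v}, {w}}] is the union [{v, w}] of its parts,
    which lies inside [A]. *)
Lemma unified_matrix_singletons (R : nzRingType) (H : hypergraph)
    (A : {set vertex H}) (v w : vertex H) :
  independent A -> v \in A -> w \in A ->
  unified_matrix R H (singleton_index v) (singleton_index w) = 0.
Proof.
move=> indA vA wA; rewrite mxE !enum_val_singleton_index.
case: existsP => // -[e /andP[eH /andP[/cover_partition defe _]]].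
have /forallP/(_ e) := indA; rewrite eH /= -defe.
by rewrite /cover bigcup_setU !big_set1 subUset !sub1set vA wA.
Qed.

Lemma independent_eigenvalues (C : numClosedFieldType) (H : hypergraph)
    (A : {set vertex H}) :
  independent A ->
  (#|A| + num_pos_eigenvalues (unified_matrix C H) <= e_index H)%N /\
  (#|A| + num_neg_eigenvalues (unified_matrix C H) <= e_index H)%N.
Proof.
move=> indA; pose f (i : 'I_#|A|) := singleton_index (enum_val i).
have f_inj : injective f by move=> i j /singleton_index_inj/enum_val_inj.
(* The rows of B are the unit vectors of the singletons {v}, v in A: they
   span the isotropic space. *)
pose B : 'M[C]_(#|A|, e_index H) := rowsub f 1%:M.
have BT : B ^t* = colsub f 1%:M.
  by apply/matrixP => i j; rewrite !mxE conjC_nat eq_sym.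
have freeB : row_free B.
  apply/row_freeP; exists (colsub f 1%:M).
  rewrite mulmx_colsub mulmx1; apply/matrixP => i j.
  by rewrite !mxE (inj_eq f_inj).
have isoB : B *m unified_matrix C H *m B ^t* = 0.
  rewrite BT mulmx_colsub mulmx1 mul_rowsub_mx mul1mx.
  apply/matrixP => i j; rewrite mxE [LHS]mxE [RHS]mxE.
  by apply: unified_matrix_singletons indA _ _; apply: enum_valP.
have hU := unified_matrix_hermitian C H.
by split; [exact: isotropic_pos_eigenvalues hU freeB isoB
          |exact: isotropic_neg_eigenvalues hU freeB isoB].
Qed.

Theorem theorem9p9 (C : numClosedFieldType) (H : hypergraph) (k lp lm : nat) :
  simple H ->
  k = e_index H ->
  lp = num_pos_eigenvalues (unified_matrix C H) ->
  lm = num_neg_eigenvalues (unified_matrix C H) ->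
  (independence_number H <= minn (k - lp) (k - lm))%N.
Proof.
move=> _ -> -> ->; apply/bigmax_leqP => A /(independent_eigenvalues C)[pos neg].
by rewrite leq_min !leq_subRL ?(leq_trans (leq_addl _ _) pos)
           ?(leq_trans (leq_addl _ _) neg) // ![(num_pos_eigenvalues _ + _)%N]addnC
           ![(num_neg_eigenvalues _ + _)%N]addnC pos neg.
Qed.
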